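(* Let $\{\cdot,\cdot\}_{C'(E)}$ be a Poisson structure of the discrete Lagrange--Poincaré system $\mathcal M=(E,L_d,\mathcal P)$ over a fiber bundle $\phi:E\to M$. If $G$ is a symmetry group of $\mathcal M$ that preserves $\{\cdot,\cdot\}_{C'(E)}$ (each $l^{C'(E)}_g$, $g\in G$, is a Poisson map) and $\mathcal A_d$ is a discrete connection on $\pi^{M,G}:M\to M/G$, then there is a Poisson structure $\{\cdot,\cdot\}_{C'(\tilde G_E)}$ of the reduced system $\mathcal M/(G,\mathcal A_d)$ such that $\Upsilon_{\mathcal A_d}:C'(E)\to C'(\tilde G_E)$ is a Poisson map, i.e. $$\Upsilon_{\mathcal A_d}^*\big(\{f_1,f_2\}_{C'(\tilde G_E)}\big)=\{\Upsilon_{\mathcal A_d}^*(f_1),\Upsilon_{\mathcal A_d}^*(f_2)\}_{C'(E)}\quad\text{for all } f_1,f_2\in C^\infty(C'(\tilde G_E)).$$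
   Context: Notation. $p_j$ is the projection of a Cartesian product on its $j$-th factor; $D_j$ is the restriction of the differential to the $j$-th factor of a product. A fiber bundle $(E,M,\phi,F)$ is a smooth map $\phi:E\to M$ of manifolds such that every $m\in M$ has an open neighborhood $U$ and a diffeomorphism $\Phi_U:\phi^{-1}(U)\to U\times F$ with $p_1\circ\Phi_U=\phi$ (a trivializing chart). For a left action $l^X$ of a Lie group $G$ on $X$, $\pi^{X,G}:X\to X/G$ is the quotient map. A principal $G$-bundle is a surjective submersion whose total space carries a smooth free left $G$-action with orbits equal to the fibers. Group action on a fiber bundle. $G$ acts on $(E,M,\phi,F)$ if there are smooth free left actions $l^E,l^M$ and a smooth right action $r^F$ on $F$ such that (1) $\pi^{M,G}:M\to M/G$ is a principal $G$-bundle; (2) $\phi$ is $G$-equivariant; (3) every $m\in M$ lies in a $G$-invariant open $U$ with a trivializing chart $\Phi_U$ that is $G$-equivariant for $l^{U\times F}_g(m,f)=(l^M_g(m),r^F_{g^{-1}}(f))$ on $U\times F$. DLPS. For a fiber bundle $\phi:E\to M$ put $C'(E)=E\times M$ and $C''(E)=\{((\epsilon_0,m_1),(\epsilon_1,m_2))\in C'(E)^2: m_1=\phi(\epsilon_1)\}$. A discrete Lagrange--Poincaré system (DLPS) over $E$ is $\mathcal M=(E,L_d,\mathcal P)$ with $L_d:C'(E)\to\mathbb R$ smooth and $\mathcal P$ an infinitesimal variation chaining map: a smooth family of linear maps $\mathcal P((\epsilon_0,m_1),(\epsilon_1,m_2)):T_{\epsilon_1}E\to\ker d\phi(\epsilon_0)\subset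 T_{\epsilon_0}E$ indexed by $C''(E)$ (a vector bundle homomorphism). Trajectories of length two and flow. An element $((\epsilon_0,m_1),(\epsilon_1,m_2))\in C''(E)$ is a trajectory of $\mathcal M$ if $d S_d(\delta\epsilon_0,\delta m_1,\delta\epsilon_1,\delta m_2)=0$, with $S_d=L_d(\epsilon_0,m_1)+L_d(\epsilon_1,m_2)$, for all variations of the form $\delta m_2=0$, $\delta\epsilon_1\in T_{\epsilon_1}E$ arbitrary, $\delta m_1=d\phi(\epsilon_1)(\delta\epsilon_1)$, $\delta\epsilon_0=\mathcal P((\epsilon_0,m_1),(\epsilon_1,m_2))(\delta\epsilon_1)$. The discrete Lagrangian flow of $\mathcal M$ is treated as a globally defined diffeomorphism $F_{\mathcal M}:C'(E)\to C'(E)$ such that $((\epsilon_0,m_1),(\epsilon_1,m_2))\in C'(E)^2$ is a trajectory of $\mathcal M$ if and only if $(\epsilon_1,m_2)=F_{\mathcal M}(\epsilon_0,m_1)$. A Poisson structure $\{\cdot,\cdot\}$ on the manifold $C'(E)$ is called a Poisson structure of $\mathcal M$ if (the flow exists and) $F_{\mathcal M}$ is a Poisson map for it. Symmetry group. $G$ is a symmetry group of $\mathcal M=(E,L_d,\mathcal P)$ if $G$ acts on the fiber bundle $E$, $L_d$ is invariant under $l^{C'(E)}_g(\epsilon_0,m_1)=(l^E_g(\epsilon_0),l^M_g(m_1))$, and $\mathcal P$ is equivariant: $\mathcal P(l^{C'(E)}_g(\epsilon_0,m_1),l^{C'(E)}_g(\epsilon_1,m_2))(dl^E_g(\delta\epsilon_1))=dl^E_g(\mathcal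 P((\epsilon_0,m_1),(\epsilon_1,m_2))(\delta\epsilon_1))$ for all $g\in G$. Discrete connections. A discrete connection $\mathcal A_d$ on a principal $G$-bundle $\pi^{M,G}:M\to M/G$ is given by a submanifold $Hor\subset M\times M$, invariant under the diagonal $G$-action and containing the diagonal, such that $(id_M\times\pi^{M,G})|_{Hor}:Hor\to M\times(M/G)$ is an injective local diffeomorphism. Convention: it is treated as globally defined (this map is onto), so that for all $m_0,m_1$ there is a unique $g=:\mathcal A_d(m_0,m_1)\in G$ with $(m_0,l^M_{g^{-1}}(m_1))\in Hor$; the function $\mathcal A_d:M\times M\to G$ is smooth. Reduction. $\tilde G_E:=(E\times G)/G$ is the quotient by $g\cdot(\epsilon,w)=(l^E_g(\epsilon),gwg^{-1})$; it is a fiber bundle over $M/G$ with projection $p^{M/G}(\pi^{E\times G,G}(\epsilon,w))=\pi^{M,G}(\phi(\epsilon))$ and fiber $F\times G$, so $C'(\tilde G_E)=\tilde G_E\times(M/G)$. Given $\mathcal A_d$, let $\Upsilon_{\mathcal A_d}:C'(E)\to C'(\tilde G_E)$, $\Upsilon_{\mathcal A_d}(\epsilon,m)=(\pi^{E\times G,G}(\epsilon,\mathcal A_d(\phi(\epsilon),m)),\pi^{M,G}(m))$. The reduced DLPS $\mathcal M/(G,\mathcal A_d)=(\tilde G_E,\check L_d,\check{\mathcal P})$ is defined by $\check L_d\circ\Upsilon_{\mathcal A_d}=L_d$ and $\check{\mathcal P}((v_0,r_1),(v_1,r_2))(\delta v_1)=D_1(p_1\circ\Upsilon_{\mathcal A_d})(\epsilon_0,m_1)(\mathcal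 P((\epsilon_0,m_1),(\epsilon_1,m_2))(\delta\epsilon_1))+D_2(p_1\circ\Upsilon_{\mathcal A_d})(\epsilon_0,m_1)(d\phi(\epsilon_1)(\delta\epsilon_1))$, where $((\epsilon_0,m_1),(\epsilon_1,m_2))\in C''(E)$ is any element with $\Upsilon_{\mathcal A_d}(\epsilon_0,m_1)=(v_0,r_1)$, $\Upsilon_{\mathcal A_d}(\epsilon_1,m_2)=(v_1,r_2)$ and $\delta\epsilon_1$ is the unique vector with $D_1(p_1\circ\Upsilon_{\mathcal A_d})(\epsilon_1,m_2)(\delta\epsilon_1)=\delta v_1$ (this is well defined). *)

(* Defs.v *)
From HB Require Import structures.
From mathcomp Require Import all_boot all_order all_algebra.
From mathcomp Require Import all_classical all_reals all_analysis.
Set Implicit Arguments.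
Unset Strict Implicit.
Unset Printing Implicit Defensive.
Import Order.TTheory GRing.Theory Num.Theory numFieldNormedType.Exports.
Local Open Scope classical_set_scope.
Local Open Scope ring_scope.

(* No manifolds are available in the libraries.  They are set up here inside
   diffeological spaces (a set together with its smooth parametrizations, called
   plots), because products and quotients X / G then carry their usual smooth
   structure by definition.  A manifold is a diffeological space that is
   Hausdorff, second countable and locally diffeomorphic to R^n; between
   manifolds, "smooth" below is ordinary C^oo smoothness.

   Partially defined maps (parametrizations, charts, trivializations) are total
   functions of which only the values on the stated domain matter. *)

Section Euclidean.
Variable R : realType.

Fixpoint iter_derive n (f : 'rV[R]_n -> R) (vs : seq 'rV[R]_n) : 'rV[R]_n -> R :=
  if vs is v :: vs' then iter_derive (fun x => 'D_v f x) vs' else f.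

(* C^oo on U (used for open U): all iterated directional derivatives exist on U
   and are differentiable there. *)
Definition smooth_on n (U : set 'rV[R]_n) (f : 'rV[R]_n -> R) :=
  forall vs x, U x -> differentiable (iter_derive f vs) x.

Definition vsmooth_on n m (U : set 'rV[R]_n) (f : 'rV[R]_n -> 'rV[R]_m) :=
  forall j, smooth_on U (fun x => f x ord0 j).

Lemma vsmooth_on_preimage n m (V : set 'rV[R]_n) (h : 'rV[R]_n -> 'rV[R]_m)
    (W : set 'rV[R]_m) :
  open V -> vsmooth_on V h -> open W -> open (V `&` h @^-1` W).
Proof.
move=> oV sh oW; rewrite openE => x [Vx Whx].
have F : Filter (nbhs x) := nbhs_filter x.
have cvg_h : h @ x --> h x.
  apply/cvg_ballP => e e0.
  have Hj (j : 'I_m) : nbhs x (fun y => ball (h x ord0 j) e (h y ord0 j)).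
    have /differentiable_continuous dj := sh j [::] x Vx.
    exact: (cvg_ball dj e0).
  have H := filter_forall F Hj.
  by apply: filterS H => y Hy; split => // i j; rewrite !ord1; exact: Hy.
apply: filterI; first exact: open_nbhs_nbhs.
by apply: cvg_h; exact: open_nbhs_nbhs.
Qed.

End Euclidean.

HB.mixin Record isDiffeological (R : realType) T := {
  plot : forall n : nat, set 'rV[R]_n -> ('rV[R]_n -> T) -> Prop ;
  plot_open : forall n U p, plot n U p -> open U ;
  plot_cst : forall n (U : set 'rV[R]_n) x, open U -> plot n U (fun=> x) ;
  plot_comp : forall n m U p (V : set 'rV[R]_m) (h : 'rV[R]_m -> 'rV[R]_n),
    plot n U p -> open V -> vsmooth_on V h -> (forall u, V u -> U (h u)) ->
    plot m V (p \o h) ;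
  plot_local : forall n U p, open U ->
    (forall u, U u -> exists V q,
        [/\ V u, plot n V q & forall y, V y -> p y = q y]) ->
    plot n U p
}.

#[short(type="diffeologicalType")]
HB.structure Definition Diffeological (R : realType) := {T of isDiffeological R T}.

Arguments plot {R s n} U p : rename.
Arguments plot_open {R s n U p} : rename.
Arguments plot_cst {R s n U} x : rename.
Arguments plot_comp {R s n m U p V h} : rename.
Arguments plot_local {R s n U p} : rename.

Section Product.
Variables (R : realType) (X Y : diffeologicalType R).

Definition prod_plot n (U : set 'rV[R]_n) (p : 'rV[R]_n -> X * Y) :=
  plot U (fun u => (p u).1) /\ plot U (fun u => (p u).2).

Fact prod_plot_open n U p : @prod_plot n U p -> open U.
Proof. by case=> /plot_open. Qed.

Fact prod_plot_cst n (U : set 'rV[R]_n) x : open U -> prod_plot U (fun=> x).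
Proof. by move=> oU; split; exact: plot_cst. Qed.

Fact prod_plot_comp n m U p (V : set 'rV[R]_m) (h : 'rV[R]_m -> 'rV[R]_n) :
  @prod_plot n U p -> open V -> vsmooth_on V h -> (forall u, V u -> U (h u)) ->
  prod_plot V (p \o h).
Proof.
move=> [p1 p2] oV sh VU.
by split; [exact: (plot_comp p1 oV sh VU) | exact: (plot_comp p2 oV sh VU)].
Qed.

Fact prod_plot_local n U p : open U ->
  (forall u, U u -> exists V q,
      [/\ V u, @prod_plot n V q & forall y, V y -> p y = q y]) -> prod_plot U p.
Proof.
move=> oU H; split; apply: plot_local => // u /H [V [q [Vu [q1 q2] pq]]].
  by exists V, (fun y => (q y).1); split => // y /pq ->.
by exists V, (fun y => (q y).2); split => // y /pq ->.
Qed.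

HB.instance Definition _ := isDiffeological.Build R (X * Y)%type
  prod_plot_open prod_plot_cst prod_plot_comp prod_plot_local.

End Product.

(* X / G as the set of orbits {l_g(x) | g}. *)
Definition orbit_space (G X : Type) (l : G -> X -> X) :=
  {A : set X | exists x, A = range (l ^~ x)}.

Definition orbit_proj (G X : Type) (l : G -> X -> X) (x : X) : orbit_space l :=
  exist _ (range (l ^~ x)) (ex_intro _ x erefl).

Definition orbit_repr (G X : Type) (l : G -> X -> X) (v : orbit_space l) : X :=
  projT1 (cid (proj2_sig v)).

Fact orbit_reprK (G X : Type) (l : G -> X -> X) :
  cancel (@orbit_repr G X l) (@orbit_proj G X l).
Proof.
case=> A eA; rewrite /orbit_proj /orbit_repr /=; case: cid => x /= Ax.
by subst A; congr exist; exact: Prop_irrelevance.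
Qed.

Section OrbitSpace.
Variables (R : realType) (G : Type) (X : diffeologicalType R) (l : G -> X -> X).

(* The quotient structure: plots are the maps that lift locally to plots of X.
   If X / G has a manifold structure making the projection a submersion, it is
   this one. *)
Definition orbit_plot n (U : set 'rV[R]_n) (p : 'rV[R]_n -> orbit_space l) :=
  open U /\ forall u, U u -> exists V q,
    [/\ V u, plot V q & forall y, V y -> p y = orbit_proj l (q y)].

Fact orbit_plot_open n U p : @orbit_plot n U p -> open U.
Proof. by case. Qed.

Fact orbit_plot_cst n (U : set 'rV[R]_n) x : open U -> orbit_plot U (fun=> x).
Proof.
move=> oU; split=> // u Uu; exists U, (fun=> orbit_repr x); split => //.
  exact: plot_cst.
by move=> y _; rewrite orbit_reprK.
Qed.

Fact orbit_plot_comp n m U p (V : set 'rV[R]_m) (h : 'rV[R]_m -> 'rV[R]_n) :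
  @orbit_plot n U p -> open V -> vsmooth_on V h -> (forall u, V u -> U (h u)) ->
  orbit_plot V (p \o h).
Proof.
move=> [oU Up] oV sh VU; split => // u Vu.
have [W [q [Whu plq pq]]] := Up _ (VU _ Vu).
exists (V `&` h @^-1` W), (q \o h); split => //.
  apply: (plot_comp plq).
  - exact: vsmooth_on_preimage oV sh (plot_open plq).
  - by move=> j vs x [Vx _]; exact: sh.
  - by move=> y [].
by move=> y [_ /pq].
Qed.

Fact orbit_plot_local n U p : open U ->
  (forall u, U u -> exists V q,
      [/\ V u, @orbit_plot n V q & forall y, V y -> p y = q y]) -> orbit_plot U p.
Proof.
move=> oU H; split=> // u /H [V [q [Vu [oV lV] pq]]].
have [W [q' [Wu plq' qq']]] := lV u Vu.
exists (V `&` W), q'; split => //.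
  apply: plot_local; first exact: openI oV (plot_open plq').
  by move=> y [_ Wy]; exists W, q'.
by move=> y [Vy Wy]; rewrite pq // qq'.
Qed.

HB.instance Definition _ := isDiffeological.Build R (orbit_space l)
  orbit_plot_open orbit_plot_cst orbit_plot_comp orbit_plot_local.

End OrbitSpace.

Section Smooth.
Variable R : realType.
Implicit Types X Y : diffeologicalType R.

Definition smooth X Y (f : X -> Y) :=
  forall n (U : set 'rV[R]_n) p, plot U p -> plot U (f \o p).

Definition smooth_in X Y (A : set X) (f : X -> Y) :=
  forall n (U : set 'rV[R]_n) p, plot U p -> (forall u, U u -> A (p u)) ->
    plot U (f \o p).

Definition smooth_fun X (f : X -> R) :=
  forall n (U : set 'rV[R]_n) p, plot U p -> smooth_on U (f \o p).

(* Open sets of the D-topology; on a manifold this is the manifold topology. *)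
Definition dopen X (A : set X) :=
  forall n (U : set 'rV[R]_n) p, plot U p -> open (U `&` p @^-1` A).

Definition diffeo X Y (f : X -> Y) :=
  smooth f /\ exists g : Y -> X, [/\ smooth g, cancel f g & cancel g f].

Definition diffeo_in X Y (A : set X) (B : set Y) (f : X -> Y) :=
  (forall x, A x -> B (f x)) /\ smooth_in A f /\
  exists g : Y -> X, [/\ forall y, B y -> A (g y), smooth_in B g,
    forall x, A x -> g (f x) = x & forall y, B y -> f (g y) = y].

(* The inverse chart psi is itself a plot, defined on the image of O. *)
Definition chart X n (O : set X) (c : X -> 'rV[R]_n) :=
  dopen O /\
  (forall m (U : set 'rV[R]_m) p, plot U p -> (forall u, U u -> O (p u)) ->
     vsmooth_on U (c \o p)) /\
  exists psi : 'rV[R]_n -> X, plot (c @` O) psi /\ forall x, O x -> psi (c x) = x.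

Definition hausdorff X := forall x y : X, x <> y ->
  exists A B : set X, [/\ dopen A, dopen B, A x, B y & A `&` B = set0].

Definition second_countable_dtop X := exists B : nat -> set X,
  (forall i, dopen (B i)) /\
  forall A x, dopen A -> A x -> exists i, B i x /\ B i `<=` A.

Definition is_manifold X :=
  hausdorff X /\ second_countable_dtop X /\
  exists n, forall x : X, exists (O : set X) (c : X -> 'rV[R]_n), chart O c /\ O x.

(* Embedded submanifolds, through slice charts of the ambient manifold. *)
Definition is_submanifold X (A : set X) := exists k n,
  forall x, A x -> exists (O : set X) (c : X -> 'rV[R]_n), [/\ chart O c, O x &
    forall y, O y -> (A y <-> forall i : 'I_n, (k <= i)%N -> c y ord0 i = 0)].

Definition local_diffeo_in X Y (A : set X) (f : X -> Y) :=
  forall x, A x -> exists W : set X, [/\ dopen W, W x,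
    dopen (f @` (A `&` W)) & diffeo_in (A `&` W) (f @` (A `&` W)) f].

End Smooth.

Section Tangent.
Variable R : realType.
Implicit Types X Y : diffeologicalType R.

Definition sfun X := {f : X -> R | smooth_fun f}.

(* Tangent vectors at x are the velocities at time 0 of smooth curves through
   x, seen as operators on C^oo(X). *)
Definition functional X := sfun X -> R.

Definition tangent X (x : X) (v : functional X) :=
  exists (U : set 'rV[R]_1) c, [/\ plot U c, U 0, c 0 = x &
    forall f : sfun X, v f = 'D_(const_mx 1) (sval f \o c) 0].

(* v(f), i.e. df(v), for f given as a plain function; 0 is a dummy value for
   non-smooth f. *)
Definition app X (v : functional X) (f : X -> R) : R :=
  if pselect (smooth_fun f) is left s then v (exist _ f s) else 0.

(* The differential of f, acting on tangent vectors. *)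
Definition dmap X Y (f : X -> Y) (v : functional X) : functional Y :=
  fun h => app v (sval h \o f).

Definition tzero X : functional X := fun=> 0.

Definition tadd X (v w : functional X) : functional X := fun f => v f + w f.

Definition tscale X (a : R) (v : functional X) : functional X := fun f => a * v f.

(* The element (v, w) of T_x X (+) T_y Y = T_(x, y) (X * Y). *)
Definition tpair X Y (x : X) (y : Y) (v : functional X) (w : functional Y) :
    functional (X * Y)%type :=
  fun f => app v (fun x' => sval f (x', y)) + app w (fun y' => sval f (x, y')).

Definition D1 X Y (Z : diffeologicalType R) (f : X * Y -> Z) (q : X * Y)
    (v : functional X) : functional Z :=
  dmap f (tpair q.1 q.2 v (@tzero Y)).

Definition D2 X Y (Z : diffeologicalType R) (f : X * Y -> Z) (q : X * Y)
    (w : functional Y) : functional Z :=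
  dmap f (tpair q.1 q.2 (@tzero X) w).

Definition submersion X Y (f : X -> Y) :=
  forall x w, tangent (f x) w -> exists2 v, tangent x v & dmap f v = w.

(* Smooth parametrizations u |-> (p u, v u) of the tangent bundle. *)
Definition tangent_plot X n (U : set 'rV[R]_n) (p : 'rV[R]_n -> X)
    (v : 'rV[R]_n -> functional X) :=
  [/\ plot U p, forall u, U u -> tangent (p u) (v u) &
      forall f : sfun X, smooth_on U (fun u => v u f)].

End Tangent.

HB.mixin Record isLieGroup (R : realType) G of Group G & isDiffeological R G := {
  lie_manifold : is_manifold (G : diffeologicalType R) ;
  lie_mul_smooth : smooth (fun q : G * G => (q.1 * q.2)%g) ;
  lie_inv_smooth : smooth (fun g : G => g^-1%g)
}.

#[short(type="lieGroupType")]
HB.structure Definition LieGroup (R : realType) :=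
  {G of Group G & isDiffeological R G & isLieGroup R G}.

Section Bundles.
Variable R : realType.
Implicit Types X Y E M F B : diffeologicalType R.
Implicit Type G : lieGroupType R.

Definition left_action G X (l : G -> X -> X) :=
  [/\ forall x, l 1%g x = x,
      forall g h x, l (g * h)%g x = l g (l h x) &
      smooth (fun q : G * X => l q.1 q.2)].

Definition right_action G X (r : G -> X -> X) :=
  [/\ forall x, r 1%g x = x,
      forall g h x, r (g * h)%g x = r h (r g x) &
      smooth (fun q : G * X => r q.1 q.2)].

Definition free_action G X (l : G -> X -> X) := forall g x, l g x = x -> g = 1%g.

Definition trivializing_chart E M F (phi : E -> M) (U : set M) (Phi : E -> M * F) :=
  [/\ dopen U, diffeo_in (phi @^-1` U) (U `*` setT) Phi &
      forall e, U (phi e) -> (Phi e).1 = phi e].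

Definition fiber_bundle E M F (phi : E -> M) :=
  [/\ is_manifold E, is_manifold M, is_manifold F, smooth phi &
      forall m, exists (U : set M) (Phi : E -> M * F),
        U m /\ trivializing_chart phi U Phi].

Definition principal_bundle G M B (l : G -> M -> M) (pi : M -> B) :=
  (is_manifold M /\ is_manifold B) /\
  [/\ smooth pi, forall b, exists m, pi m = b & submersion pi] /\
  [/\ left_action l, free_action l &
      forall m m', pi m = pi m' <-> exists g, m' = l g m].

Definition acts_on_bundle G E M F (phi : E -> M)
    (lE : G -> E -> E) (lM : G -> M -> M) (rF : G -> F -> F) :=
  [/\ left_action lE /\ free_action lE, left_action lM /\ free_action lM &
      right_action rF] /\
  [/\ principal_bundle lM (orbit_proj lM),
      forall g e, phi (lE g e) = lM g (phi e) &
      forall m, exists (U : set M) (Phi : E -> M * F),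
        [/\ U m, forall g m', U m' -> U (lM g m'), trivializing_chart phi U Phi &
            forall g e, U (phi e) ->
              Phi (lE g e) = (lM g (Phi e).1, rF g^-1%g (Phi e).2)]].

End Bundles.

Section Poisson.
Variable R : realType.
Implicit Types X Y : diffeologicalType R.

(* Only the values of a bracket on smooth functions matter. *)
Definition bracket X := (X -> R) -> (X -> R) -> X -> R.

Definition is_poisson X (br : bracket X) :=
  [/\ forall f g, smooth_fun f -> smooth_fun g -> smooth_fun (br f g),
      forall f g, smooth_fun f -> smooth_fun g -> forall x, br f g x = - br g f x,
      forall (a : R) f g h, smooth_fun f -> smooth_fun g -> smooth_fun h ->
        forall x, br (fun y => a * f y + g y) h x = a * br f h x + br g h x,
      forall f g h, smooth_fun f -> smooth_fun g -> smooth_fun h ->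
        forall x, br (fun y => f y * g y) h x = f x * br g h x + g x * br f h x &
      forall f g h, smooth_fun f -> smooth_fun g -> smooth_fun h ->
        forall x, br f (br g h) x + br g (br h f) x + br h (br f g) x = 0].

Definition poisson_map X Y (brX : bracket X) (brY : bracket Y) (f : X -> Y) :=
  smooth f /\
  forall h k, smooth_fun h -> smooth_fun k ->
    brY h k \o f = brX (h \o f) (k \o f).

End Poisson.

Section DLPS.
Variable R : realType.
Implicit Types E M F : diffeologicalType R.
Implicit Type G : lieGroupType R.

(* C'(E) is E * M, and C''(E) is a subset of C'(E) * C'(E). *)
Definition C2 E M (phi : E -> M) (c0 c1 : E * M) := c0.2 = phi c1.1.

Record dlps_data E M := DlpsData {
  dlagr : E * M -> R ;
  ivc : E * M -> E * M -> functional E -> functional E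
}.

(* Infinitesimal variation chaining maps; the last clause is the smoothness of
   the vector bundle homomorphism over C''(E). *)
Definition is_ivcm E M (phi : E -> M)
    (P : E * M -> E * M -> functional E -> functional E) :=
  [/\ forall c0 c1 v, C2 phi c0 c1 -> tangent c1.1 v ->
        tangent c0.1 (P c0 c1 v) /\ dmap phi (P c0 c1 v) = @tzero R M,
      forall c0 c1 (a : R) v w, C2 phi c0 c1 -> tangent c1.1 v -> tangent c1.1 w ->
        P c0 c1 (tadd (tscale a v) w) = tadd (tscale a (P c0 c1 v)) (P c0 c1 w) &
      forall n (U : set 'rV[R]_n) (c0 c1 : 'rV[R]_n -> E * M)
             (v : 'rV[R]_n -> functional E),
        plot U c0 -> plot U c1 -> (forall u, U u -> C2 phi (c0 u) (c1 u)) ->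
        tangent_plot U (fun u => (c1 u).1) v ->
        tangent_plot U (fun u => (c0 u).1) (fun u => P (c0 u) (c1 u) (v u))].

Definition is_dlps E M F (phi : E -> M) (D : dlps_data E M) :=
  [/\ fiber_bundle F phi, smooth_fun (dlagr D) & is_ivcm phi (ivc D)].

Definition trajectory E M (phi : E -> M) (D : dlps_data E M) (c0 c1 : E * M) :=
  C2 phi c0 c1 /\
  forall de1, tangent c1.1 de1 ->
    let de0 := ivc D c0 c1 de1 in
    let dm1 := dmap phi de1 in
    let dm2 := @tzero R M in
    let S (q : (E * M) * (E * M)) := dlagr D q.1 + dlagr D q.2 in
    app (tpair c0 c1 (tpair c0.1 c0.2 de0 dm1) (tpair c1.1 c1.2 de1 dm2)) S = 0.

Definition is_flow E M (phi : E -> M) (D : dlps_data E M) (Fl : E * M -> E * M) :=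
  diffeo Fl /\ forall c0 c1, trajectory phi D c0 c1 <-> c1 = Fl c0.

Definition poisson_structure_of E M (phi : E -> M) (D : dlps_data E M)
    (br : bracket (E * M)%type) :=
  is_poisson br /\ exists Fl, is_flow phi D Fl /\ poisson_map br br Fl.

Definition act_C1 G E M (lE : G -> E -> E) (lM : G -> M -> M) (g : G) (c : E * M) :
    E * M := (lE g c.1, lM g c.2).

Definition symmetry_group G E M F (phi : E -> M) (D : dlps_data E M)
    (lE : G -> E -> E) (lM : G -> M -> M) (rF : G -> F -> F) :=
  [/\ acts_on_bundle phi lE lM rF,
      forall g c, dlagr D (act_C1 lE lM g c) = dlagr D c &
      forall g c0 c1 v, C2 phi c0 c1 -> tangent c1.1 v ->
        ivc D (act_C1 lE lM g c0) (act_C1 lE lM g c1) (dmap (lE g) v) =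
        dmap (lE g) (ivc D c0 c1 v)].

(* A discrete connection, given by Hor together with the (uniquely determined)
   map A_d : M * M -> G; both are globally defined. *)
Definition discrete_connection G M (lM : G -> M -> M) (Hor : set (M * M))
    (Ad : M -> M -> G) :=
  let f (q : M * M) : M * orbit_space lM := (q.1, orbit_proj lM q.2) in
  [/\ is_submanifold Hor,
      forall g m0 m1, Hor (m0, m1) -> Hor (lM g m0, lM g m1) &
      forall m, Hor (m, m)] /\
  [/\ set_inj Hor f, local_diffeo_in Hor f & f @` Hor = setT] /\
  (forall m0 m1 g, Hor (m0, lM g^-1%g m1) <-> g = Ad m0 m1) /\
  smooth (fun q : M * M => Ad q.1 q.2).

End DLPS.

Section Reduction.
Variables (R : realType) (G : lieGroupType R) (E M : diffeologicalType R).
Variables (phi : E -> M) (lE : G -> E -> E) (lM : G -> M -> M) (Ad : M -> M -> G).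

Definition conj_act (g : G) (q : E * G) : E * G :=
  (lE g q.1, (g * q.2 * g^-1)%g).

(* (E * G) / G *)
Definition GE := orbit_space conj_act.

(* The projection of GE onto M / G, computed on a representative; by equivariance
   of phi the choice is irrelevant. *)
Definition GE_proj (v : GE) : orbit_space lM :=
  orbit_proj lM (phi (orbit_repr v).1).

Definition Upsilon (c : E * M) : GE * orbit_space lM :=
  (orbit_proj conj_act (c.1, Ad (phi c.1) c.2), orbit_proj lM c.2).

Definition Upsilon1 (c : E * M) : GE := (Upsilon c).1.

(* The reduced system, computed on a chosen lift.  Lifts exist whenever
   Upsilon is onto (for the variational map: on C'' of the reduced bundle and on
   tangent vectors), and then the values do not depend on the choice;
   0 is a dummy value elsewhere. *)
Definition reduced_dlagr (L : E * M -> R) (c : GE * orbit_space lM) : R :=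
  if pselect (exists x, Upsilon x = c) is left e then L (projT1 (cid e)) else 0.

Definition is_lift (c0 c1 : GE * orbit_space lM) (dv1 : functional GE)
    (t : (E * M) * (E * M) * functional E) :=
  let: (x0, x1, de1) := t in
  [/\ C2 phi x0 x1, Upsilon x0 = c0, Upsilon x1 = c1, tangent x1.1 de1 &
      D1 Upsilon1 x1 de1 = dv1].

Definition reduced_ivc (P : E * M -> E * M -> functional E -> functional E)
    (c0 c1 : GE * orbit_space lM) (dv1 : functional GE) : functional GE :=
  if pselect (exists t, is_lift c0 c1 dv1 t) is left e then
    let: (x0, x1, de1) := projT1 (cid e) in
    tadd (D1 Upsilon1 x0 (P x0 x1 de1)) (D2 Upsilon1 x0 (dmap phi de1))
  else @tzero R GE.

Definition reduced_dlps (D : dlps_data E M) : dlps_data GE (orbit_space lM) :=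
  DlpsData (reduced_dlagr (dlagr D)) (reduced_ivc (ivc D)).

End Reduction.

(* Main.v *)
(* Upsilon is smooth, plots of its target lift locally through it, and its fibres
   are the G-orbits of C'(E): two points with the same image differ by (g, h) in
   G x G, and comparing values of A_d forces g = h.  So G-invariant smooth data on
   C'(E) descend, in particular the bracket and (being equivariant) the flow.
   What remains is that the descended flow is the flow of the reduced system.
   For fixed m the map Upsilon1(., m) : E -> GE is a global diffeomorphism, hence
   D_1 Upsilon1 is bijective on tangent vectors, lifts of reduced variations are
   unique up to G, and by the chain rule the variation of the reduced action is
   that of the action at any lift. *)
Require Import Defs.
From mathcomp Require Import all_boot all_order all_algebra.
From mathcomp Require Import all_classical all_reals all_analysis.
Set Implicit Arguments.
Unset Strict Implicit.
Unset Printing Implicit Defensive.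
Import Order.TTheory GRing.Theory Num.Theory numFieldNormedType.Exports.
Local Open Scope classical_set_scope.
Local Open Scope ring_scope.

(** * Smooth functions on subsets of R^n *)

Section Calculus.
Variable R : realType.

(** Only the germ at [a] matters: the first-order expansion of [f] is also one of [g], and
    [diff_unique] identifies its linear part with the differential of [g]. *)
Lemma near_eq_differentiable (V W : normedModType R) (f g : V -> W) (a : V) :
  {near a, f =1 g} -> differentiable f a -> differentiable g a.
Proof.
move=> fg df.
have E : g \o shift a = cst (g a) + 'd f a +o_ 0 id.
  apply/eqaddoP => e e0.
  have := diff_locally df => /eqaddoP /(_ e e0) H.
  have Na : \forall h \near (0 : V), f (h + a) = g (h + a).
    by have := fg; rewrite (near_shift 0) /=; apply: filterS => h /=; rewrite subr0.
  near=> h.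
  have Eh : f (h + a) = g (h + a) by near: h.
  rewrite /= /GRing.add /GRing.opp /= -Eh -(nbhs_singleton fg).
  by near: h.
have cf : continuous ('d f a) by exact: diff_continuous.
by apply/diff_locallyP; rewrite (diff_unique cf E).
Unshelve. all: by end_near. Qed.

(** Agreement on an open set passes to all iterated derivatives, so smoothness can be tested against
    local models. *)
Lemma smooth_on_local n (U : set 'rV[R]_n) (f : 'rV[R]_n -> R) :
  (forall x, U x -> exists V g,
     [/\ open V, V x, smooth_on V g & forall y, V y -> f y = g y]) ->
  smooth_on U f.
Proof.
move=> H vs x /H [V [g [oV Vx sg]]] {H}.
have: forall y, V y -> differentiable (iter_derive g vs) y by move=> y; exact: sg.
elim: vs f g {sg} => [|v vs IH] f g /= sg fg.
  apply: near_eq_differentiable (sg x Vx).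
  by near do rewrite fg //; exact: open_nbhs_nbhs.
apply: IH sg _ => y Vy; apply: near_eq_derive.
by near do rewrite fg //; exact: open_nbhs_nbhs.
Unshelve. all: by end_near. Qed.

Lemma smooth_on_cst n (U : set 'rV[R]_n) (a : R) : smooth_on U (cst a).
Proof.
move=> vs; elim: vs a => [|v vs IH] a x Ux /=; first exact: differentiable_cst.
rewrite (_ : (fun _ => _) = cst 0); first exact: IH.
by apply/funext => y; rewrite derive_cst.
Qed.

Lemma smooth_on_coord n (U : set 'rV[R]_n) (i : 'I_n) :
  smooth_on U (fun x => x ord0 i).
Proof.
move=> [|v vs] x Ux; first exact: differentiable_coord.
rewrite /= (_ : (fun _ => _) = cst (v ord0 i)); first exact: smooth_on_cst Ux.
apply/funext => y; apply/cvg_lim => //; apply: cvg_near_cst.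
near=> h; rewrite /= !mxE addrK [LHS]mulrA mulVf ?mul1r //.
by near: h; exact: nbhs_dnbhs_neq.
Unshelve. all: by end_near. Qed.

Lemma smooth_onD n (U : set 'rV[R]_n) (f g : 'rV[R]_n -> R) : open U ->
  smooth_on U f -> smooth_on U g -> smooth_on U (fun x => f x + g x).
Proof.
move=> oU.
(* The induction admits any [h] equal to the sum on [U] only: off [U] the derivative of a sum need
   not be the sum of the derivatives. *)
suff H vs (h f' g' : 'rV[R]_n -> R) : smooth_on U f' -> smooth_on U g' ->
    (forall y, U y -> h y = f' y + g' y) ->
    forall x, U x -> differentiable (iter_derive h vs) x.
  by move=> sf sg vs; exact: (H _ _ f g).
elim: vs h f' g' => [|v vs IH] h f' g' sf sg hE x Ux /=.
  apply: (@near_eq_differentiable _ _ (f' + g')).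
    by near do rewrite hE //; exact: open_nbhs_nbhs.
  by apply: differentiableD; [exact: sf [::] x Ux | exact: sg [::] x Ux].
apply: (IH _ (fun x => 'D_v f' x) (fun x => 'D_v g' x)) => //.
- by move=> ws; exact: sf (v :: ws).
- by move=> ws; exact: sg (v :: ws).
move=> y Uy; rewrite (@near_eq_derive _ _ _ h (f' + g')); last first.
  by near do rewrite hE //; exact: open_nbhs_nbhs.
by apply: deriveD; apply: diff_derivable;
  [exact: (sf [::] y Uy) | exact: (sg [::] y Uy)].
Unshelve. all: by end_near. Qed.

Lemma derive_comp_linear n m (f : 'rV[R]_m -> R) (i : 'rV[R]_n -> 'rV[R]_m) v :
  linear i -> 'D_v (f \o i) 0 = 'D_(i v) f 0.
Proof.
move=> li.
have i0 : i 0 = 0 by have := li (-1) 0 0; rewrite scaler0 addr0 scaleN1r addNr.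
have E h : h^-1 *: (((f \o i) \o shift 0) (h *: v) - (f \o i) 0) =
    h^-1 *: ((f \o shift 0) (h *: i v) - f 0).
  by rewrite /= !addr0 i0; have := li h v 0; rewrite i0 !addr0 => ->.
by rewrite /derive (funext E).
Qed.

(** The differential at 0 is linear and (1, 1) = (1, 0) + (0, 1); each direction enters as a linear
    map from R to R^2. *)
Lemma derive_diag (h : 'rV[R]_2 -> R) : differentiable h 0 ->
  'D_(const_mx 1) (fun x : 'rV[R]_1 => h (\row_i x ord0 ord0)) 0 =
  'D_(const_mx 1) (fun x : 'rV[R]_1 =>
     h (\row_i (if i == ord0 then x ord0 ord0 else 0))) 0 +
  'D_(const_mx 1) (fun x : 'rV[R]_1 =>
     h (\row_i (if i == ord0 then 0 else x ord0 ord0))) 0.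
Proof.
move=> dh.
pose d (x : 'rV[R]_1) : 'rV[R]_2 := \row_i x ord0 ord0.
pose i1 (x : 'rV[R]_1) : 'rV[R]_2 := \row_i (if i == ord0 then x ord0 ord0 else 0).
pose i2 (x : 'rV[R]_1) : 'rV[R]_2 := \row_i (if i == ord0 then 0 else x ord0 ord0).
rewrite (@derive_comp_linear _ _ h d); last first.
  by move=> a x y; apply/rowP => i; rewrite !mxE.
rewrite (@derive_comp_linear _ _ h i1); last first.
  by move=> a x y; apply/rowP => i; rewrite !mxE; case: ifP; rewrite ?mulr0 ?addr0.
rewrite (@derive_comp_linear _ _ h i2); last first.
  by move=> a x y; apply/rowP => i; rewrite !mxE; case: ifP; rewrite ?mulr0 ?addr0.
rewrite !deriveE // -linearD; congr ('d h 0 _); apply/rowP => i; rewrite !mxE.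
by case: ifP; rewrite ?addr0 ?add0r.
Qed.

End Calculus.

(** * Smooth maps, subductions and tangent functionals *)

Section Diffeology.
Variable R : realType.
Implicit Types X Y Z : diffeologicalType R.

Lemma smooth_comp X Y Z (g : Y -> Z) (f : X -> Y) :
  smooth g -> smooth f -> smooth (g \o f).
Proof. by move=> sg sf n U p /sf /sg. Qed.

Lemma smooth_cst X Y (y : Y) : smooth (fun _ : X => y).
Proof. by move=> n U p /plot_open; exact: plot_cst. Qed.

Lemma smooth_fst X Y : smooth (@fst X Y).
Proof. by move=> n U p []. Qed.

Lemma smooth_snd X Y : smooth (@snd X Y).
Proof. by move=> n U p []. Qed.

Lemma smooth_pair X Y Z (f : X -> Y) (g : X -> Z) :
  smooth f -> smooth g -> smooth (fun x => (f x, g x)).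
Proof. by move=> sf sg n U p pp; split; [exact: sf pp | exact: sg pp]. Qed.

Lemma smooth_pairl X Y (y : Y) : smooth (fun x : X => (x, y)).
Proof. by apply: smooth_pair => [n U p //|]; exact: smooth_cst. Qed.

Lemma smooth_pairr X Y (x : X) : smooth (fun y : Y => (x, y)).
Proof. by apply: smooth_pair => [|n U p //]; exact: smooth_cst. Qed.

Lemma smooth_fun_comp X Y (h : Y -> R) (f : X -> Y) :
  smooth_fun h -> smooth f -> smooth_fun (h \o f).
Proof. by move=> sh sf n U p /sf /sh. Qed.

Lemma smooth_funD X (f g : X -> R) :
  smooth_fun f -> smooth_fun g -> smooth_fun (fun x => f x + g x).
Proof.
move=> sf sg n U p pp.
by apply: (smooth_onD (plot_open pp)); [exact: sf pp | exact: sg pp].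
Qed.

Lemma smooth_fun_cst X (a : R) : smooth_fun (fun _ : X => a).
Proof. by move=> n U p _; exact: smooth_on_cst. Qed.

(** The quotient maps of diffeology, reduced to the local lifting of plots; smoothness of [f] is
    assumed separately. *)
Definition subduction X Y (f : X -> Y) :=
  forall n (U : set 'rV[R]_n) p, plot U p -> forall u, U u ->
    exists V q, [/\ V u, plot V q & forall z, V z -> p z = f (q z)].

Lemma smooth_subduction X Y Z (f : X -> Y) (g : Y -> Z) :
  subduction f -> smooth (g \o f) -> smooth g.
Proof.
move=> sf sg n U p pp; apply: plot_local (plot_open pp) _ => u /(sf _ _ _ pp).
move=> [V [q [Vu pq fq]]]; exists V, (g \o f \o q); split => //; first exact: sg.
by move=> z /fq /= ->.
Qed.

Lemma smooth_fun_subduction X Y (f : X -> Y) (g : Y -> R) :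
  subduction f -> smooth_fun (g \o f) -> smooth_fun g.
Proof.
move=> sf sg n U p pp; apply: smooth_on_local => u /(sf _ _ _ pp).
move=> [V [q [Vu pq fq]]]; exists V, (g \o f \o q); split => //.
- exact: plot_open pq.
- exact: sg.
- by move=> z /fq /= ->.
Qed.

(** A point is a constant plot on R^0, and lifting this plot gives a preimage. *)
Lemma subduction_surj X Y (f : X -> Y) y : subduction f -> exists x, f x = y.
Proof.
move=> /(_ 0 setT (fun=> y) (plot_cst _ openT) 0 I) [V [q [V0 _ /(_ 0 V0) ->]]].
by exists (q 0).
Qed.

Lemma plot_sub X n (U V : set 'rV[R]_n) (p : 'rV[R]_n -> X) :
  plot U p -> open V -> V `<=` U -> plot V p.
Proof.
move=> pp oV VU; apply: plot_local oV _ => u Vu.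
by exists U, p; split => //; exact: VU.
Qed.

Lemma smooth_orbit_proj (G : Type) X (l : G -> X -> X) : smooth (orbit_proj l).
Proof.
by move=> n U p pp; split=> [|u Uu]; [exact: plot_open pp | exists U, p].
Qed.

Lemma subduction_orbit_proj (G : Type) X (l : G -> X -> X) :
  subduction (orbit_proj l).
Proof. by move=> n U p [_]. Qed.

Lemma app_smooth X (v : functional X) (f : X -> R) (sf : smooth_fun f) :
  app v f = v (exist _ f sf).
Proof.
rewrite /app; case: pselect => [s|//].
by rewrite (Prop_irrelevance s sf).
Qed.

Lemma app_sval X (v : functional X) (h : Defs.sfun X) : app v (sval h) = v h.
Proof. by case: h => f sf; exact: app_smooth. Qed.

Lemma app_tzero X (f : X -> R) : app (@tzero R X) f = 0.
Proof. by rewrite /app; case: pselect. Qed.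

Lemma app_tadd X (v w : functional X) (f : X -> R) :
  app (tadd v w) f = app v f + app w f.
Proof. by rewrite /app; case: pselect => //; rewrite addr0. Qed.

Lemma app_dmap X Y (f : X -> Y) (v : functional X) (h : Y -> R) :
  smooth_fun h -> app (dmap f v) h = app v (h \o f).
Proof. by move=> sh; rewrite (app_smooth _ sh). Qed.

Lemma dmap_comp X Y Z (g : Y -> Z) (f : X -> Y) (v : functional X) :
  smooth g -> dmap g (dmap f v) = dmap (g \o f) v.
Proof.
move=> sg; apply/funext => -[h sh]; rewrite /dmap /= app_dmap //.
exact: smooth_fun_comp.
Qed.

Lemma dmap_id X (v : functional X) : dmap id v = v.
Proof. by apply/funext => h; exact: app_sval. Qed.

Lemma tangent_dmap X Y (f : X -> Y) x (v : functional X) :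
  smooth f -> tangent x v -> tangent (f x) (dmap f v).
Proof.
move=> sf [U [c [pc U0 c0 vE]]]; exists U, (f \o c); split => //=.
- exact: sf.
- by rewrite c0.
- move=> [h sh]; rewrite /dmap /=.
  by rewrite (app_smooth _ (smooth_fun_comp sh sf)) vE.
Qed.

Lemma app_tpair X Y x y (v : functional X) (w : functional Y) (f : X * Y -> R) :
  smooth_fun f ->
  app (tpair x y v w) f = app v (fun x' => f (x', y)) + app w (fun y' => f (x, y')).
Proof. by move=> sf; rewrite (app_smooth _ sf). Qed.

Lemma D1E X Y Z (f : X * Y -> Z) q (v : functional X) : smooth f ->
  D1 f q v = dmap (fun x => f (x, q.2)) v.
Proof.
move=> sf; apply/funext => -[h sh]; rewrite /D1 /dmap /=.
by rewrite app_tpair ?app_tzero ?addr0 //; exact: smooth_fun_comp.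
Qed.

Lemma D2E X Y Z (f : X * Y -> Z) q (w : functional Y) : smooth f ->
  D2 f q w = dmap (fun y => f (q.1, y)) w.
Proof.
move=> sf; apply/funext => -[h sh]; rewrite /D2 /dmap /=.
by rewrite app_tpair ?app_tzero ?add0r //; exact: smooth_fun_comp.
Qed.

(** For a curve [c] with velocity [v], pulling [H] back by (s, t) -> (c s, c t) gives a smooth
    function near 0 in R^2, to which [derive_diag] applies. *)
Lemma app_diag X x (v : functional X) (H : X * X -> R) : tangent x v ->
  smooth_fun H ->
  app v (fun y => H (y, y)) = app v (fun y => H (y, x)) + app v (fun y => H (x, y)).
Proof.
move=> [U [c [pc U0 c0 vE]]] sH.
have sd : smooth (fun y : X => (y, y)) by apply: smooth_pair => n V p.
rewrite (app_smooth _ (smooth_fun_comp sH sd)).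
rewrite (app_smooth _ (smooth_fun_comp sH (smooth_pairl x))).
rewrite (app_smooth _ (smooth_fun_comp sH (smooth_pairr x))) !vE /=.
pose pr (i : 'I_2) (x : 'rV[R]_2) : 'rV[R]_1 := \row__ x ord0 i.
have spr i : vsmooth_on setT (pr i).
  move=> j; have -> : (fun z => pr i z ord0 j) = (fun z : 'rV[R]_2 => z ord0 i).
    by apply/funext => z; rewrite mxE.
  exact: smooth_on_coord.
(* [U2] is U x U inside R^2: both times stay in the domain of [c]. *)
pose U2 := (setT `&` pr ord0 @^-1` U) `&` (setT `&` pr (lift ord0 ord0) @^-1` U).
have oU2 : open U2.
  by apply: openI; apply: (vsmooth_on_preimage openT (spr _)); exact: plot_open pc.
have prU i u : U2 u -> U (pr i u).
  by case=> -[_ u0] [_ u1]; case: (unliftP ord0 i) => [j ->|-> //]; rewrite ord1.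
pose c2 i := c \o pr i.
have pc2 i : plot U2 (c2 i).
  apply: (plot_comp pc oU2) (prU i) => j vs z _; exact: (spr i j vs z I).
have sh := sH _ _ (fun u => (c2 ord0 u, c2 (lift ord0 ord0) u))
  (conj (pc2 _) (pc2 _)).
have pr0 i : pr i 0 = 0 by apply/rowP => j; rewrite !mxE.
have U20 : U2 0 by rewrite /U2 /= !pr0.
have eqF (f g : 'rV[R]_1 -> R) : f =1 g ->
  'D_(const_mx 1) f 0 = 'D_(const_mx 1) g 0 by move=> /funext ->.
have rE i (f : 'I_2 -> R) : pr i (\row_k f k) = const_mx (f i).
  by apply/rowP => k; rewrite !mxE.
have cE (z : 'rV[R]_1) : const_mx (z ord0 ord0) = z.
  by apply/rowP => k; rewrite mxE (ord1 k).
have c00 : c (const_mx 0) = x by rewrite -c0; congr c; apply/rowP => k; rewrite !mxE.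
have sh0 := sh [::] 0 U20.
apply: (etrans (eqF _ _ _) (etrans (derive_diag sh0)
  (congr2 +%R (eqF _ _ _) (eqF _ _ _)))) => z /=; congr (H (_, _));
  by rewrite /c2 /= rE /= ?cE ?c00.
Qed.

End Diffeology.

(** * Descent of maps and Poisson brackets along a subduction *)

Section PoissonQuotient.
Variables (R : realType) (X Y : diffeologicalType R) (pi : X -> Y).
Hypotheses (pi_smooth : smooth pi) (pi_sub : subduction pi).

(** The section [s] is an arbitrary choice of preimages; smoothness of [f \o s] is tested after
    composing with [pi], where it becomes [f]. *)
Lemma smooth_descends (Z : diffeologicalType R) (f : X -> Z) : smooth f ->
  (forall x x', pi x = pi x' -> f x = f x') ->
  exists2 f' : Y -> Z, smooth f' & forall x, f' (pi x) = f x.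
Proof.
move=> sf fE; have /choice[s sK] y := subduction_surj y pi_sub.
have f'E x : f (s (pi x)) = f x by apply: fE; rewrite sK.
exists (f \o s) => //; apply: (smooth_subduction pi_sub).
by rewrite (_ : _ \o _ = f) //; exact/funext.
Qed.

(** The forward implication makes [f] descend, the backward one its inverse. *)
Lemma diffeo_descends (f : X -> X) : diffeo f ->
  (forall x x', pi x = pi x' <-> pi (f x) = pi (f x')) ->
  exists2 f' : Y -> Y, diffeo f' & forall x, f' (pi x) = pi (f x).
Proof.
move=> [sf [g [sg fK gK]]] fE.
have [f' sf' f'E] : exists2 f' : Y -> Y, smooth f' &
    forall x, f' (pi x) = (pi \o f) x.
  by apply: smooth_descends => [|x x' /fE//]; exact: smooth_comp.
have [g' sg' g'E] : exists2 g' : Y -> Y, smooth g' &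
    forall x, g' (pi x) = (pi \o g) x.
  apply: smooth_descends => [|x x' xx']; first exact: smooth_comp.
  by apply/fE; rewrite !gK.
exists f' => //; split=> //; exists g'; split=> // y;
  have [x <-] := subduction_surj y pi_sub.
- by rewrite f'E g'E /= fK.
- by rewrite g'E f'E /= gK.
Qed.

(** Brackets of pulled-back functions are constant on fibres: two points of a fibre are joined by a
    Poisson map [a] over the identity of [Y], and [a] fixes every pulled-back function. The axioms
    are then read at the chosen preimage [s y]. *)
Lemma poisson_descends (br : bracket X) : is_poisson br ->
  (forall x x', pi x = pi x' ->
     exists a : X -> X, [/\ poisson_map br br a, pi \o a = pi & x' = a x]) ->
  exists2 br' : bracket Y, is_poisson br' & poisson_map br br' pi.
Proof.
move=> [brS brA brL brM brJ] orb.
have [s sK] := choice (fun y => subduction_surj y pi_sub).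
pose br' : bracket Y := fun f g y => br (f \o pi) (g \o pi) (s y).
have spi (f : Y -> R) : smooth_fun f -> smooth_fun (f \o pi).
  by move=> sf; exact: smooth_fun_comp.
have br'E f g : smooth_fun f -> smooth_fun g ->
    br' f g \o pi = br (f \o pi) (g \o pi).
  move=> sf sg; apply/funext => x; rewrite /= /br'.
  have [a [[_ aP] pia ax]] := orb _ _ (sK (pi x)).
  have E (h : Y -> R) : (h \o pi) \o a = h \o pi by rewrite -compA pia.
  rewrite [in RHS]ax; have := aP _ _ (spi f sf) (spi g sg).
  by rewrite !E => /(congr1 (@^~ (s (pi x)))).
exists br'; last by split.
have br'S f g : smooth_fun f -> smooth_fun g -> smooth_fun (br' f g).
  move=> sf sg; apply: (smooth_fun_subduction pi_sub).
  by rewrite br'E //; apply: brS; exact: spi.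
split=> //.
- by move=> f g sf sg y; apply: brA; exact: spi.
- by move=> a f g h sf sg sh y; apply: (brL a (f \o pi) (g \o pi)); exact: spi.
(* The bare factors [f y] and [g y] become values of the pulled-back functions at [s y]. *)
- move=> f g h sf sg sh y; rewrite /br' -{2 4}(sK y).
  by apply: (brM (f \o pi) (g \o pi)); exact: spi.
(* Only the outer brackets are unfolded; the pullbacks of the inner ones are brackets upstairs by
   [br'E]. *)
- move=> f g h sf sg sh y; rewrite {1 3 5}/br' !br'E //.
  by apply: brJ; exact: spi.
Qed.

Lemma poisson_map_descends (br : bracket X) (br' : bracket Y) f f' :
  poisson_map br br' pi -> poisson_map br br f -> smooth f' ->
  (forall x, f' (pi x) = pi (f x)) -> poisson_map br' br' f'.
Proof.
move=> [_ piP] [_ fP] sf' f'E; split=> // h k sh sk; apply/funext => y.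
have [x <-] := subduction_surj y pi_sub; rewrite /= f'E.
have E g : (g \o f') \o pi = (g \o pi) \o f :> (X -> R).
  by apply/funext => z; rewrite /= f'E.
have /(congr1 (fun g => g (f x))) /= -> := piP _ _ sh sk.
have sp g : smooth_fun g -> smooth_fun (g \o pi).
  by move=> sg; exact: smooth_fun_comp.
have /(congr1 (fun g => g x)) /= -> := fP _ _ (sp _ sh) (sp _ sk).
have sf g : smooth_fun g -> smooth_fun (g \o f').
  by move=> sg; exact: smooth_fun_comp.
by have /(congr1 (fun g => g x)) /= -> := piP _ _ (sf _ sh) (sf _ sk); rewrite !E.
Qed.

End PoissonQuotient.

Lemma orbit_projP (G : groupType) (X : Type) (l : G -> X -> X) (x y : X) :
  (forall x, l 1%g x = x) -> (forall g h x, l (g * h)%g x = l g (l h x)) ->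
  orbit_proj l x = orbit_proj l y <-> exists g, y = l g x.
Proof.
move=> l1 lM; split=> [/(congr1 (@proj1_sig _ _)) /= /seteqP[_ /(_ y)]|[g ->]].
  by case=> [|g _ <-]; [exists 1%g | exists g].
rewrite /orbit_proj; have E : range (l ^~ x) = range (l ^~ (l g x)).
  apply/seteqP; split=> z [h _ <-] /=.
    by exists (h * g^-1)%g => //; rewrite -lM mulgVK.
  by exists (h * g)%g => //; rewrite lM.
by apply: eq_exist.
Qed.

(** * Discrete connections and horizontal lifts *)

Section DiscreteConnection.
Variables (R : realType) (G : lieGroupType R) (M : diffeologicalType R).
Variables (lM : G -> M -> M) (Hor : set (M * M)) (Ad : M -> M -> G).
Hypothesis lM_act : left_action lM.
Hypothesis conn : discrete_connection lM Hor Ad.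

Let lM1 x : lM 1%g x = x. Proof. by case: lM_act. Qed.
Let lMM g h x : lM (g * h)%g x = lM g (lM h x). Proof. by case: lM_act. Qed.

Lemma Hor_Ad m0 m1 : Hor (m0, lM (Ad m0 m1)^-1%g m1).
Proof. by case: conn => _ [_ [AdP _]]; apply/AdP. Qed.

Lemma Ad_unique m0 m1 g : Hor (m0, lM g^-1%g m1) -> Ad m0 m1 = g.
Proof. by case: conn => _ [_ [AdP _]] /AdP. Qed.

Lemma Ad_diag m : Ad m m = 1%g.
Proof.
by apply: Ad_unique; rewrite invg1 lM1; case: conn => -[_ _ diag] _; exact: diag.
Qed.

Lemma Ad_actr h m0 m1 : Ad m0 (lM h m1) = (h * Ad m0 m1)%g.
Proof. by apply: Ad_unique; rewrite -lMM invgM mulgVK; exact: Hor_Ad. Qed.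

Lemma Ad_orbit m g : Ad m (lM g m) = g.
Proof. by rewrite Ad_actr Ad_diag mulg1. Qed.

(** Invariance of [Hor] moves the horizontal pair of [(m0, m1)] by [g]. The resulting conjugation is
    the one built into [conj_act]. *)
Lemma Ad_act g m0 m1 : Ad (lM g m0) (lM g m1) = (g * Ad m0 m1 * g^-1)%g.
Proof.
apply: Ad_unique; rewrite -lMM !invgM invgK -!mulgA mulVg mulg1 lMM.
by case: conn => -[_ inv _] _; apply/inv/Hor_Ad.
Qed.

(** Horizontal lifts exist because the map on [Hor] is onto; its injectivity forces the chosen lift
    to agree with the smooth local inverses. *)
Lemma Hor_section : exists2 s : M * orbit_space lM -> M, smooth s &
  forall q, Hor (q.1, s q) /\ orbit_proj lM (s q) = q.2.
Proof.
case: conn => _ [[inj ld onto] _].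
have /choice[s sP] q : exists m, Hor (q.1, m) /\ orbit_proj lM m = q.2.
  have: setT q by []. rewrite -onto => -[[m0 m1] H <-] /=.
  by exists m1.
exists s => // n U p pp; apply: plot_local (plot_open pp) _ => u Uu.
have [H _] := sP (p u).
have [W [oW Wu ofW [_ [_ [g [gA sg _ fgK]]]]]] := ld _ H.
set f := (fun q : M * M => (q.1, orbit_proj lM q.2)) in inj ld onto ofW gA sg fgK.
have fs q : f (q.1, s q) = q.
  by rewrite /f /=; case: (sP q) => _ ->; case: q.
(* The image of [Hor] inside [W] is D-open, so the local inverse [g] applies to [p] near [u]. *)
exists (U `&` p @^-1` (f @` (Hor `&` W))), (fun z => (g (p z)).2); split.
- by split=> //; exists ((p u).1, s (p u)); rewrite ?fs.
- apply: smooth_snd; apply: (sg _ _ p) => [|z []//].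
  exact: (plot_sub pp (ofW _ _ _ pp)).
move=> z [_ Bz]; have [sH _] := sP (p z).
suff <- : ((p z).1, s (p z)) = g (p z) by [].
have [Hg _] := gA _ Bz.
by apply: inj; rewrite ?inE //; exact: (etrans (fs _) (esym (fgK _ Bz))).
Qed.

End DiscreteConnection.

(** * The differential of the discrete action *)

Section Variation.
Variables (R : realType) (E M : diffeologicalType R) (phi : E -> M).
Implicit Types (L : E * M -> R) (c : E * M).

(** The contributions of eps_0, m_1 and eps_1 to the differential of S_d. The arguments are
    arbitrary functionals, not known to kill constants, so the constant summands are kept. *)
Definition variation L c0 c1 (de0 de1 : functional E) :=
  app de0 (fun e => L (e, c0.2) + L c1) +
  app (dmap phi de1) (fun m => L (c0.1, m) + L c1) +
  app de1 (fun e => L c0 + L (e, c1.2)).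

Lemma trajectoryE (D : dlps_data E M) c0 c1 : smooth_fun (dlagr D) ->
  trajectory phi D c0 c1 <-> C2 phi c0 c1 /\
    forall de1, tangent c1.1 de1 ->
      variation (dlagr D) c0 c1 (ivc D c0 c1 de1) de1 = 0.
Proof.
move=> sL.
suff actionE de0 dm1 de1 :
    app (tpair c0 c1 (tpair c0.1 c0.2 de0 dm1) (tpair c1.1 c1.2 de1 (@tzero R M)))
      (fun q => dlagr D q.1 + dlagr D q.2) =
    app de0 (fun e => dlagr D (e, c0.2) + dlagr D c1) +
    app dm1 (fun m => dlagr D (c0.1, m) + dlagr D c1) +
    app de1 (fun e => dlagr D c0 + dlagr D (e, c1.2)).
  rewrite /trajectory /variation.
  by split=> -[C H]; split=> // de1 /H; rewrite actionE.
have sS : smooth_fun (fun q : (E * M) * (E * M) => dlagr D q.1 + dlagr D q.2).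
  by apply: smooth_funD; apply: (smooth_fun_comp sL);
    [exact: smooth_fst | exact: smooth_snd].
rewrite app_tpair //.
rewrite (app_tpair _ _ _ _ (smooth_fun_comp sS (@smooth_pairl _ _ _ c1))).
rewrite (app_tpair _ _ _ _ (smooth_fun_comp sS (@smooth_pairr _ _ _ c0))) /=.
by rewrite app_tzero addr0.
Qed.

End Variation.

(** * Fibres, local lifts and slices of [Upsilon] *)

Section Reduction.
Variables (R : realType) (G : lieGroupType R) (E M : diffeologicalType R).
Variables (phi : E -> M) (lE : G -> E -> E) (lM : G -> M -> M).
Variables (Hor : set (M * M)) (Ad : M -> M -> G).
Hypotheses (phi_smooth : smooth phi) (lE_act : left_action lE).
Hypotheses (lM_act : left_action lM) (lM_free : free_action lM).
Hypothesis phiE : forall g e, phi (lE g e) = lM g (phi e).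
Hypothesis conn : discrete_connection lM Hor Ad.

Local Notation Ups := (Upsilon phi lE lM Ad).
Local Notation Ups1 := (Upsilon1 phi lE lM Ad).
Local Notation act := (act_C1 lE lM).

Let lE1 x : lE 1%g x = x. Proof. by case: lE_act. Qed.
Let lEM g h x : lE (g * h)%g x = lE g (lE h x). Proof. by case: lE_act. Qed.
Let lE_smooth : smooth (fun q : G * E => lE q.1 q.2). Proof. by case: lE_act. Qed.
Let lM1 x : lM 1%g x = x. Proof. by case: lM_act. Qed.
Let lMM g h x : lM (g * h)%g x = lM g (lM h x). Proof. by case: lM_act. Qed.
Let lM_smooth : smooth (fun q : G * M => lM q.1 q.2). Proof. by case: lM_act. Qed.
Let Ad_smooth : smooth (fun q : M * M => Ad q.1 q.2).
Proof. by case: conn => _ [_ []]. Qed.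

Lemma orbit_proj_lMP m m' :
  orbit_proj lM m = orbit_proj lM m' <-> exists g, m' = lM g m.
Proof. exact: orbit_projP. Qed.

Lemma orbit_proj_conjP q q' :
  orbit_proj (conj_act lE) q = orbit_proj (conj_act lE) q' <->
  exists g, q' = conj_act lE g q.
Proof.
apply: orbit_projP => [[e w]|g h [e w]]; rewrite /conj_act /=.
  by rewrite lE1 mul1g invg1 mulg1.
by rewrite lEM invgM !mulgA.
Qed.

Lemma Upsilon1_smooth : smooth Ups1.
Proof.
apply: (smooth_comp (f := fun c => (c.1, Ad (phi c.1) c.2))
  (smooth_orbit_proj (conj_act lE))).
apply: smooth_pair (@smooth_fst _ _ _) _.
apply: (smooth_comp (f := fun c => (phi c.1, c.2)) Ad_smooth).
by apply: smooth_pair (@smooth_snd _ _ _); exact: smooth_comp (@smooth_fst _ _ _).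
Qed.

Lemma Upsilon_smooth : smooth Ups.
Proof.
apply: smooth_pair Upsilon1_smooth _.
exact: smooth_comp (smooth_orbit_proj lM) (@smooth_snd _ _ _).
Qed.

Lemma Upsilon_act g x : Ups (act g x) = Ups x.
Proof.
rewrite /Upsilon /act_C1 /=; congr (_, _); apply/esym.
  apply/orbit_proj_conjP; exists g.
  by rewrite /conj_act /= phiE (Ad_act lM_act conn).
by apply/orbit_proj_lMP; exists g.
Qed.

Lemma UpsilonP x y : Ups x = Ups y <-> exists g, y = act g x.
Proof.
split=> [xy|[g ->]]; last by rewrite Upsilon_act.
have /orbit_proj_conjP[g [y1 Ay]] := congr1 fst xy.
have /orbit_proj_lMP[h y2] := congr1 snd xy.
exists g; rewrite /act_C1 -y1 [LHS]surjective_pairing y2; congr (_, lM _ _).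
(* Both sides are an element of G times [Ad (lM g (phi x.1)) x.2]; cancelling this factor identifies
   [h] with [g]. *)
move: Ay; rewrite y1 phiE y2 -(Ad_act lM_act conn) !(Ad_actr lM_act conn).
exact: mulIg.
Qed.

Lemma act_C2 g x0 x1 : C2 phi x0 x1 -> C2 phi (act g x0) (act g x1).
Proof. by rewrite /C2 /= phiE => ->. Qed.

(* By freeness, the condition m_1 = phi(eps_1) makes the same g work for both
   points. *)
Lemma UpsilonP2 x0 x1 y0 y1 : C2 phi x0 x1 -> C2 phi y0 y1 ->
  Ups x0 = Ups y0 -> Ups x1 = Ups y1 ->
  exists g, y0 = act g x0 /\ y1 = act g x1.
Proof.
move=> Cx Cy /UpsilonP[g y0E] /UpsilonP[h y1E]; exists g; split=> //.
suff -> : g = h by [].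
move: Cy; rewrite /C2 y0E y1E /= phiE -Cx => gh.
have : lM (h^-1 * g)%g x0.2 = x0.2 by rewrite lMM gh -lMM mulVg lM1.
by move=> /lM_free /(congr1 ( *%g h)); rewrite mulVKg mulg1.
Qed.

(** Locally the first component of a plot lifts to some (e, w). Its second component r is lifted to
    w applied to the horizontal point over phi(e) in the orbit r; that point has [Ad] value 1, so
    the lift has value w. *)
Lemma Upsilon_subduction : subduction Ups.
Proof.
have [s ss sP] := Hor_section conn.
move=> n U p pp u Uu; have [p1 p2] := pp.
have [V [q [Vu pq qE]]] := subduction_orbit_proj p1 Uu.
have oUV : open (U `&` V) by apply: openI (plot_open pp) (plot_open pq).
have pq' : plot (U `&` V) q by apply: plot_sub pq oUV _ => z [].
have p2' : plot (U `&` V) (fun z => (p z).2) by apply: plot_sub p2 oUV _ => z [].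
pose b z := s (phi (q z).1, (p z).2).
exists (U `&` V), (fun z => ((q z).1, lM (q z).2 (b z))); split=> //.
  case: (pq') => pq1 pq2; split=> //=.
  apply: (lM_smooth (p := fun z => ((q z).2, b z))); split=> //=.
  apply: (ss _ _ (fun z => (phi (q z).1, (p z).2))).
  by split=> //=; exact: phi_smooth.
move=> z [_ Vz]; have [Hb bE] := sP (phi (q z).1, (p z).2).
rewrite [LHS]surjective_pairing qE // /Upsilon /=; congr (_, _).
  rewrite (Ad_actr lM_act conn) (_ : Ad _ _ = 1%g) ?mulg1 -?surjective_pairing //.
  by apply: (Ad_unique conn); rewrite invg1 lM1.
by rewrite -[LHS]bE; apply/orbit_proj_lMP; exists (q z).2.
Qed.

(* The inverse sends [e', w] to g e', where m' is the point of the orbit of m with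
   Ad (phi e') m' = w and g moves m' to m; explicitly g = Ad m' m. *)
Lemma Upsilon1_slice m : exists inv : GE lE -> E,
  [/\ smooth inv, cancel (fun e => Ups1 (e, m)) inv &
      cancel inv (fun e => Ups1 (e, m))].
Proof.
have [s ss sP] := Hor_section conn.
pose m' (q : E * G) := lM q.2 (s (phi q.1, orbit_proj lM m)).
have sm' : smooth m'.
  apply: (smooth_comp (f := fun q : E * G =>
    (q.2, s (phi q.1, orbit_proj lM m))) lM_smooth).
  apply: smooth_pair (@smooth_snd _ _ _) _.
  apply: (smooth_comp (f := fun q : E * G => (phi q.1, orbit_proj lM m)) ss).
  apply: smooth_pair; last exact: smooth_cst.
  exact: smooth_comp (@smooth_fst _ _ _).
have m'O q : exists g, m = lM g (m' q).
  apply/orbit_proj_lMP; have [_ /= <-] := sP (phi q.1, orbit_proj lM m).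
  by apply/esym/orbit_proj_lMP; exists q.2.
have Am' q : Ad (phi q.1) (m' q) = q.2.
  apply: (Ad_unique conn); rewrite -lMM mulVg lM1.
  by have [] := sP (phi q.1, orbit_proj lM m).
(* On a single orbit a point is determined by its [Ad] value. *)
have m'_unique q y : Ad (phi q.1) y = q.2 -> orbit_proj lM y = orbit_proj lM m ->
    m' q = y.
  move=> Ay yO; have [g mE] := m'O q.
  have: orbit_proj lM (m' q) = orbit_proj lM y.
    by rewrite yO; apply/orbit_proj_lMP; exists g.
  move=> /orbit_proj_lMP[h yE]; move: Ay.
  rewrite yE (Ad_actr lM_act conn) Am' => /(congr1 ( *%g^~ q.2^-1%g)).
  by rewrite mulgK mulgV => ->; rewrite lM1.
pose F q := lE (Ad (m' q) m) q.1.
have sF : smooth F.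
  apply: (smooth_comp (f := fun q => (Ad (m' q) m, q.1)) lE_smooth).
  apply: smooth_pair (@smooth_fst _ _ _).
  apply: (smooth_comp (f := fun q => (m' q, m)) Ad_smooth).
  by apply: smooth_pair sm' _; exact: smooth_cst.
have [inv sinv invE] : exists2 inv : GE lE -> E, smooth inv &
    forall q, inv (orbit_proj (conj_act lE) q) = F q.
  apply: (smooth_descends (@subduction_orbit_proj _ _ _ _) sF).
  (* [F] is constant on orbits: translating [q] by [g] replaces the element [a] taking [m' q] to [m]
     by a g^-1, and g cancels. *)
  move=> q q' /orbit_proj_conjP[g ->]; have [a mE] := m'O q.
  have m'g : m' (conj_act lE g q) = lM g (m' q).
    apply: m'_unique; rewrite /= ?phiE ?(Ad_act lM_act conn) ?Am' //.
    by apply/orbit_proj_lMP; exists (a * g^-1)%g; rewrite -lMM mulgVK.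
  have Aa : Ad (m' q) m = a.
    by rewrite -[RHS](Ad_orbit lM_act conn (m' q)) -mE.
  have Ag : Ad (lM g (m' q)) m = (a * g^-1)%g.
    by rewrite -[RHS](Ad_orbit lM_act conn (lM g (m' q))) -lMM mulgVK -mE.
  by rewrite /F m'g Aa Ag /= -lEM mulgVK.
have UpsE e : Ups1 (e, m) = orbit_proj (conj_act lE) (e, Ad (phi e) m) by [].
exists inv; split=> // [e|v].
  by rewrite UpsE invE /F (m'_unique _ m) //= (Ad_diag lM_act conn) lE1.
have [q <-] := subduction_surj v (@subduction_orbit_proj _ _ _ (conj_act lE)).
rewrite invE UpsE /F /=; have [a mE] := m'O q.
apply/esym/orbit_proj_conjP; exists a; rewrite /conj_act.
have -> : Ad (m' q) m = a by rewrite -[RHS](Ad_orbit lM_act conn (m' q)) -mE.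
by rewrite phiE [X in Ad _ X]mE (Ad_act lM_act conn) Am'.
Qed.

(** * The reduced bundle projection and lifts of composable pairs *)

Lemma GE_proj_orbit_proj q :
  GE_proj phi lM (orbit_proj (conj_act lE) q) = orbit_proj lM (phi q.1).
Proof.
rewrite /GE_proj; set q' := orbit_repr _.
have /orbit_proj_conjP[g ->] :
    orbit_proj (conj_act lE) q' = orbit_proj (conj_act lE) q.
  exact: orbit_reprK.
by rewrite /= phiE; apply/orbit_proj_lMP; exists g.
Qed.

Lemma GE_proj_smooth : smooth (GE_proj phi lM : GE lE -> _).
Proof.
apply: (smooth_subduction (@subduction_orbit_proj _ _ _ (conj_act lE))).
rewrite (_ : _ \o _ = orbit_proj lM \o phi \o fst).
  apply: smooth_comp (@smooth_fst _ _ _).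
  exact: smooth_comp (@smooth_orbit_proj _ _ _ _) phi_smooth.
by apply/funext => q; exact: GE_proj_orbit_proj.
Qed.

Lemma C2_Upsilon x0 x1 : C2 phi x0 x1 -> C2 (GE_proj phi lM) (Ups x0) (Ups x1).
Proof. by rewrite /C2 GE_proj_orbit_proj /= => ->. Qed.

(** Independent lifts match only up to some [g]; translating the first by [g] repairs this and keeps
    its image. *)
Lemma C2_lift c0 c1 : C2 (GE_proj phi lM) c0 c1 ->
  exists x0 x1, [/\ C2 phi x0 x1, Ups x0 = c0 & Ups x1 = c1].
Proof.
have [y0 <-] := subduction_surj c0 Upsilon_subduction.
have [y1 <-] := subduction_surj c1 Upsilon_subduction.
rewrite /C2 GE_proj_orbit_proj => /orbit_proj_lMP[g yE].
by exists (act g y0), y1; split; rewrite ?Upsilon_act.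
Qed.

(** * Tangent maps of the slices *)

Lemma D1_Upsilon1 x (v : functional E) :
  D1 Ups1 x v = dmap (fun e => Ups1 (e, x.2)) v.
Proof. exact/D1E/Upsilon1_smooth. Qed.

Lemma D1_Upsilon1_inj x : injective (D1 Ups1 x).
Proof.
have [inv [sinv fK _]] := Upsilon1_slice x.2.
apply: (can_inj (g := dmap inv)) => v; rewrite D1_Upsilon1 dmap_comp //.
by rewrite (_ : _ \o _ = id) ?dmap_id //; exact/funext.
Qed.

Lemma D1_Upsilon1_surj x (w : functional (GE lE)) : tangent (Ups1 x) w ->
  exists2 v, tangent x.1 v & D1 Ups1 x v = w.
Proof.
have [inv [sinv fK gK]] := Upsilon1_slice x.2.
move=> /(tangent_dmap sinv) tw; exists (dmap inv w).
  by rewrite -[x.1]fK -surjective_pairing.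
have ss : smooth (fun e => Ups1 (e, x.2)).
  exact: smooth_comp Upsilon1_smooth (@smooth_pairl _ _ _ _).
by rewrite D1_Upsilon1 dmap_comp // (_ : _ \o _ = id) ?dmap_id //; exact/funext.
Qed.

Let smooth_lE g : smooth (lE g).
Proof. exact: smooth_comp lE_smooth (@smooth_pairr _ _ _ g). Qed.

Let smooth_lM g : smooth (lM g).
Proof. exact: smooth_comp lM_smooth (@smooth_pairr _ _ _ g). Qed.

Lemma D1_Upsilon1_act g x (v : functional E) :
  D1 Ups1 (act g x) (dmap (lE g) v) = D1 Ups1 x v.
Proof.
rewrite !D1_Upsilon1 dmap_comp; last first.
  exact: smooth_comp Upsilon1_smooth (@smooth_pairl _ _ _ _).
by congr dmap; apply/funext => e; exact: (congr1 fst (Upsilon_act g (e, x.2))).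
Qed.

(** * Variations, trajectories and flow of the reduced system *)

Variable D : dlps_data E M.
Hypothesis L_smooth : smooth_fun (dlagr D).
Hypothesis L_inv : forall g c, dlagr D (act g c) = dlagr D c.
Hypothesis P_equiv : forall g c0 c1 v, C2 phi c0 c1 -> tangent c1.1 v ->
  ivc D (act g c0) (act g c1) (dmap (lE g) v) = dmap (lE g) (ivc D c0 c1 v).

Local Notation D' := (reduced_dlps phi lE lM Ad D).

Lemma reduced_dlagrE x : dlagr D' (Ups x) = dlagr D x.
Proof.
rewrite /= /reduced_dlagr; case: pselect => [e|[]]; last by exists x.
by case: cid => y /= /UpsilonP[g ->]; rewrite L_inv.
Qed.

Lemma reduced_dlagr_smooth : smooth_fun (dlagr D').
Proof.
apply: (smooth_fun_subduction Upsilon_subduction).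
by rewrite (_ : _ \o _ = dlagr D) //; apply/funext => x; exact: reduced_dlagrE.
Qed.

Lemma variation_act g x0 x1 (de0 de1 : functional E) :
  variation phi (dlagr D) (act g x0) (act g x1) (dmap (lE g) de0) (dmap (lE g) de1)
  = variation phi (dlagr D) x0 x1 de0 de1.
Proof.
(* Smoothness of the slices is what [app_dmap] requires, [app] being 0 on non-smooth functions. *)
have sl y k : smooth_fun (fun e => dlagr D (e, y) + k).
  apply: smooth_funD (@smooth_fun_cst _ _ _).
  exact: smooth_fun_comp L_smooth (@smooth_pairl _ _ _ y).
have sl' y k : smooth_fun (fun e => k + dlagr D (e, y)).
  apply: smooth_funD (@smooth_fun_cst _ _ _) _.
  exact: smooth_fun_comp L_smooth (@smooth_pairl _ _ _ y).
have sr y k : smooth_fun (fun m => dlagr D (y, m) + k).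
  apply: smooth_funD (@smooth_fun_cst _ _ _).
  exact: smooth_fun_comp L_smooth (@smooth_pairr _ _ _ y).
rewrite /variation.
have -> : dmap phi (dmap (lE g) de1) = dmap (lM g) (dmap phi de1).
  by rewrite !dmap_comp //; congr dmap; apply/funext => e; exact: phiE.
rewrite !(app_dmap _ _ (sl _ _)) !(app_dmap _ _ (sl' _ _)).
rewrite (app_dmap (lM g) _ (sr _ _)) !L_inv.
by congr (_ + _ + _); congr (@app _ _ _ _); apply/funext => z /=; congr (_ + _);
  rewrite -[RHS](L_inv g).
Qed.

(* The chain rule along the diagonal of M * M accounts for the two ways in which
   m_1 enters L = check L o Upsilon: through A_d in v_0 and through r_1. *)
Lemma variation_Upsilon x0 x1 (de0 de1 : functional E) :
  C2 phi x0 x1 -> tangent x1.1 de1 ->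
  variation (GE_proj phi lM) (dlagr D') (Ups x0) (Ups x1)
    (tadd (D1 Ups1 x0 de0) (D2 Ups1 x0 (dmap phi de1))) (D1 Ups1 x1 de1)
  = variation phi (dlagr D) x0 x1 de0 de1.
Proof.
move=> Cx te.
have sL' := reduced_dlagr_smooth.
have sl y k : smooth_fun (fun e => dlagr D' (e, y) + k).
  apply: smooth_funD (@smooth_fun_cst _ _ _).
  exact: smooth_fun_comp sL' (@smooth_pairl _ _ _ y).
have sl' y k : smooth_fun (fun e => k + dlagr D' (e, y)).
  apply: smooth_funD (@smooth_fun_cst _ _ _) _.
  exact: smooth_fun_comp sL' (@smooth_pairl _ _ _ y).
have sr y k : smooth_fun (fun m => dlagr D' (y, m) + k).
  apply: smooth_funD (@smooth_fun_cst _ _ _).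
  exact: smooth_fun_comp sL' (@smooth_pairr _ _ _ y).
have GEpE : dmap (GE_proj phi lM) (D1 Ups1 x1 de1) =
    dmap (orbit_proj lM) (dmap phi de1).
  rewrite D1_Upsilon1 dmap_comp; last exact: GE_proj_smooth.
  rewrite dmap_comp; last exact: smooth_orbit_proj.
  by congr dmap; apply/funext => e; exact: GE_proj_orbit_proj.
rewrite /variation GEpE app_tadd D2E; last exact: Upsilon1_smooth.
rewrite !D1_Upsilon1 !(app_dmap _ _ (sl _ _)) (app_dmap _ _ (sl' _ _)).
rewrite (app_dmap _ _ (sr _ _)) -(addrA (app de0 _)).
(* The two terms driven by [dmap phi de1] are now adjacent; [H] separates the two roles of m_1 so
   that they are its partial derivatives. *)
pose H (q : M * M) := dlagr D' (Ups1 (x0.1, q.1), orbit_proj lM q.2) + dlagr D x1.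
have sH : smooth_fun H.
  apply: smooth_funD (@smooth_fun_cst _ _ _).
  apply: (smooth_fun_comp (f := fun q : M * M =>
    (Ups1 (x0.1, q.1), orbit_proj lM q.2)) sL').
  apply: smooth_pair.
    apply: (smooth_comp (f := fun q : M * M => (x0.1, q.1)) Upsilon1_smooth).
    exact: smooth_comp (@smooth_pairr _ _ _ _) (@smooth_fst _ _ _).
  exact: smooth_comp (smooth_orbit_proj lM) (@smooth_snd _ _ _).
(* The condition m_1 = phi(eps_1) puts this vector at the base point of the diagonal rule. *)
have tw : tangent x0.2 (dmap phi de1) by rewrite Cx; exact: tangent_dmap.
have := app_diag tw sH; rewrite /H /= => diagE.
congr (_ + _ + _).
- by congr (@app _ _ _ _); apply/funext => e /=; rewrite -!reduced_dlagrE.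
- transitivity (app (dmap phi de1) (fun m =>
    dlagr D' (Ups (x0.1, m)) + dlagr D x1)); last first.
    by congr (@app _ _ _ _); apply/funext => m; rewrite reduced_dlagrE.
  rewrite [RHS]diagE; congr (_ + _); congr (@app _ _ _ _); apply/funext => m /=;
    by rewrite -reduced_dlagrE -?surjective_pairing.
- by congr (@app _ _ _ _); apply/funext => e /=; rewrite -!reduced_dlagrE.
Qed.

(** The lift chosen inside [reduced_ivc] is a translate of the given one: on points by [UpsilonP2],
    on vectors by [D1_Upsilon1_inj]. Equivariance of [ivc D] and [variation_act] remove the
    translation. *)
Lemma variation_reduced_ivc x0 x1 (de1 : functional E) :
  C2 phi x0 x1 -> tangent x1.1 de1 -> let dv1 := D1 Ups1 x1 de1 in
  variation (GE_proj phi lM) (dlagr D') (Ups x0) (Ups x1)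
    (ivc D' (Ups x0) (Ups x1) dv1) dv1
  = variation phi (dlagr D) x0 x1 (ivc D x0 x1 de1) de1.
Proof.
move=> Cx te dv1; rewrite [ivc D']/= /reduced_ivc.
case: pselect => [e|[]]; last by exists (x0, x1, de1).
case: (cid e) => -[[y0 y1] v] /= [Cy y0E y1E tv vE].
have [g [gy0 gy1]] := UpsilonP2 Cx Cy (esym y0E) (esym y1E).
have ve : v = dmap (lE g) de1.
  by apply: (@D1_Upsilon1_inj y1); rewrite vE gy1 D1_Upsilon1_act.
rewrite -vE -y0E -y1E (variation_Upsilon _ Cy tv) gy0 gy1 ve P_equiv //.
exact: variation_act.
Qed.

(** Since D1 of [Upsilon1] is onto on tangent vectors, testing all reduced variations amounts to
    testing all [de1]. *)
Lemma reduced_trajectory x0 x1 : C2 phi x0 x1 ->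
  trajectory (GE_proj phi lM) D' (Ups x0) (Ups x1) <-> trajectory phi D x0 x1.
Proof.
move=> Cx; rewrite !trajectoryE //; last exact: reduced_dlagr_smooth.
split=> -[_ H]; split=> //; last 1 first.
- move=> w /(@D1_Upsilon1_surj x1)[v tv <-].
  by rewrite variation_reduced_ivc //; exact: H.
- move=> de te; rewrite -variation_reduced_ivc //; apply: H; rewrite D1_Upsilon1.
  rewrite [(Ups x1).1](_ : _ = Ups1 (x1.1, x1.2)) -?surjective_pairing //.
  apply: (tangent_dmap (f := fun e => Ups1 (e, x1.2))) te.
  exact: smooth_comp Upsilon1_smooth (@smooth_pairl _ _ _ _).
- exact: C2_Upsilon.
Qed.

(** A translated pair has the same image, so [reduced_trajectory] is applied down and back up. *)
Lemma trajectory_act g x0 x1 :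
  trajectory phi D x0 x1 -> trajectory phi D (act g x0) (act g x1).
Proof.
move=> t; have [Cx _] := t; apply/reduced_trajectory; first exact: act_C2.
by rewrite !Upsilon_act; apply/reduced_trajectory.
Qed.

(** Uniqueness of the successor makes [Fl] commute with G, hence descend; reduced trajectories are
    compared with it on lifts given by [C2_lift]. *)
Lemma reduced_flow Fl : is_flow phi D Fl ->
  exists2 Fl', is_flow (GE_proj phi lM) D' Fl' & forall x, Fl' (Ups x) = Ups (Fl x).
Proof.
move=> [dFl FlP]; have [_ [Fi [_ FlK _]]] := dFl.
have FlC x : C2 phi x (Fl x) by have [] := (FlP x (Fl x)).2 erefl.
have Fl_act g x : Fl (act g x) = act g (Fl x).
  by apply/esym/FlP/trajectory_act/FlP.
have [|Fl' dFl' Fl'E] := diffeo_descends Upsilon_smooth Upsilon_subduction dFl.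
  move=> x x'; rewrite !UpsilonP; split=> -[g]; first by move->; exists g.
  by rewrite -Fl_act => /(can_inj FlK) ->; exists g.
exists Fl' => //; split=> // c0 c1; split=> [t|->].
  have [Cc _] := t; have [x0 [x1 [Cx x0E x1E]]] := C2_lift Cc.
  by move: t; rewrite -x0E -x1E Fl'E reduced_trajectory // => /FlP ->.
have [x <-] := subduction_surj c0 Upsilon_subduction.
by rewrite Fl'E; apply/reduced_trajectory => //; apply/FlP.
Qed.

Lemma reduced_poisson_structure (br : bracket (E * M)%type) :
  poisson_structure_of phi D br -> (forall g, poisson_map br br (act g)) ->
  exists br' : bracket (GE lE * orbit_space lM)%type,
    poisson_structure_of (GE_proj phi lM) D' br' /\ poisson_map br br' Ups.
Proof.
move=> [brP [Fl [FlP Flbr]]] actP.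
have [|br' br'P Upsbr] := poisson_descends Upsilon_smooth Upsilon_subduction brP.
  (* Points of a fibre are joined by [act g], a Poisson map covering the identity. *)
  move=> x x' /UpsilonP[g ->]; exists (act g); split=> //.
  by apply/funext => z; exact: Upsilon_act.
exists br'; split=> //; split=> //.
have [Fl' Fl'P Fl'E] := reduced_flow FlP; exists Fl'; split=> //.
have [[sFl' _] _] := Fl'P.
exact: (poisson_map_descends Upsilon_smooth Upsilon_subduction Upsbr Flbr sFl').
Qed.

End Reduction.

Theorem proposition8p2 (R : realType) (E M F : diffeologicalType R)
    (G : lieGroupType R) (phi : E -> M) (D : dlps_data E M)
    (br : bracket (E * M)%type)
    (lE : G -> E -> E) (lM : G -> M -> M) (rF : G -> F -> F)
    (Hor : set (M * M)) (Ad : M -> M -> G) :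
  is_dlps F phi D ->
  poisson_structure_of phi D br ->
  symmetry_group phi D lE lM rF ->
  (forall g, poisson_map br br (act_C1 lE lM g)) ->
  discrete_connection lM Hor Ad ->
  exists br' : bracket (GE lE * orbit_space lM)%type,
    poisson_structure_of (@GE_proj R G E M phi lE lM)
      (reduced_dlps phi lE lM Ad D) br' /\
    poisson_map br br' (Upsilon phi lE lM Ad).
Proof.
move=> [[_ _ _ sphi _] sL _] brD [[[[lEa _] [lMa lMf] _] [_ phiE _]] L_inv P_eq].
move=> actP conn.
exact: (reduced_poisson_structure sphi lEa lMa lMf phiE conn sL L_inv P_eq brD actP).
Qed.
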